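(* Let $R$ be a semiring, $V$ an $R$-module, and let $(A_1,\dots,A_n)$ and $(W_1,\dots,W_n)$ be $n$-tuples of submodules of $V$ such that $W_k\subset A_k$ and $W_k$ is summand absorbing in $A_k$ for $k=1,\dots,n$, and $W_i\cap A_j\subset W_j$ for any two different $i,j\in\{1,\dots,n\}$. Assume that $(A_1,\dots,A_n)$ has amalgamation in $V$. Then: (a) If tuples $(a_1,\dots,a_n)\in A_1\times\cdots\times A_n$ and $(w_1,\dots,w_n)\in W_1\times\cdots\times W_n$ are exchange equivalent in $A_1\times\cdots\times A_n$, then $(a_1,\dots,a_n)\in W_1\times\cdots\times W_n$, and both tuples are exchange equivalent in $W_1\times\cdots\times W_n$. (b) $W_1+\cdots+W_n$ is a summand absorbing submodule of $A_1+\cdots+A_n$.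
   Context: $R$ is a semiring with $0$ and $1$, and $R$-module means left $R$-(semi)module; no subtraction is assumed. For submodules $W\subset A$ of $V$, $W$ is summand absorbing (SA) in $A$ if for all $x,y\in A$, $x+y\in W$ implies $x\in W$ and $y\in W$. Exchange equivalence. Let $A_1,\dots,A_n$ be submodules of $V$. A basic exchange in $A_1\times\cdots\times A_n$ is a pair of tuples $(a_1,\dots,a_n),(a'_1,\dots,a'_n)\in A_1\times\cdots\times A_n$ for which there are $i\ne j$ and $d\in A_i\cap A_j$ with $a_i=a'_i+d$, $a'_j=a_j+d$, and $a_k=a'_k$ for $k\ne i,j$. Two tuples are exchange equivalent in $A_1\times\cdots\times A_n$ if they are connected by a finite chain of tuples in $A_1\times\cdots\times A_n$ in which any two consecutive members form, in one order or the other, a basic exchange. The same definition applies to $W_1\times\cdots\times W_n$ (with $d\in W_i\cap W_j$). Exchange equivalent tuples have the same sum in $V$. The tuple $(A_1,\dots,A_n)$ has amalgamation in $V$ if any two tuples $(a_1,\dots,a_n),(b_1,\dots,b_n)\in A_1\times\cdots\times A_n$ with $a_1+\cdots+a_n=b_1+\cdots+b_n$ are exchange equivalent in $A_1\times\cdots\times A_n$. *)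

(* Defs.v *)
From Stdlib Require Import Relation_Operators.
From mathcomp Require Import all_boot all_algebra.
From mathcomp Require Import boolp classical_sets.

Set Implicit Arguments.
Unset Strict Implicit.
Unset Printing Implicit Defensive.

Import GRing.Theory.
Local Open Scope ring_scope.
Local Open Scope classical_set_scope.

Definition is_submodule (R : pzSemiRingType) (V : lSemiModType R) (A : set V) :
  Prop := GRing.subsemimod_closed (mem A).

Definition summand_absorbing (V : nmodType) (W A : set V) : Prop :=
  forall x y : V, A x -> A y -> W (x + y) -> W x /\ W y.

Definition tuples_in (V : nmodType) (n : nat) (A : 'I_n -> set V) :
  set {ffun 'I_n -> V} := [set a | forall i : 'I_n, A i (a i)].

Definition sumset (V : nmodType) (n : nat) (A : 'I_n -> set V) : set V :=
  [set \sum_(i < n) a i | a in tuples_in A].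

Definition basic_exchange (V : nmodType) (n : nat) (A : 'I_n -> set V)
    (a a' : {ffun 'I_n -> V}) : Prop :=
  [/\ tuples_in A a, tuples_in A a' &
      exists (i j : 'I_n) (d : V),
        [/\ i <> j, (A i `&` A j) d, a i = a' i + d, a' j = a j + d &
            forall k : 'I_n, k <> i -> k <> j -> a k = a' k]].

(* The membership clauses matter only for the one-element chain: clos_refl_trans
   is reflexive also at tuples outside the product. *)
Definition exchange_equivalent (V : nmodType) (n : nat) (A : 'I_n -> set V)
    (a b : {ffun 'I_n -> V}) : Prop :=
  [/\ tuples_in A a, tuples_in A b &
      clos_refl_trans {ffun 'I_n -> V}
        (fun x y => basic_exchange A x y \/ basic_exchange A y x) a b].

Definition has_amalgamation (V : nmodType) (n : nat) (A : 'I_n -> set V) : Prop :=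
  forall a b : {ffun 'I_n -> V}, tuples_in A a -> tuples_in A b ->
    \sum_(i < n) a i = \sum_(i < n) b i -> exchange_equivalent A a b.

(* Main.v *)
(* A basic exchange moves a summand d from one slot to another.  When the
   receiving tuple lies in the W_k, summand absorption puts d in W_j, and the
   condition W_j `&` A_i `<=` W_i puts it in W_i as well; so the exchange takes
   place inside the W_k, and this propagates along chains. *)
Require Import Defs.
From Stdlib Require Import Relation_Operators Operators_Properties.
From mathcomp Require Import all_boot all_algebra.
From mathcomp Require Import boolp classical_sets.

Import GRing.Theory.
Local Open Scope ring_scope.
Local Open Scope classical_set_scope.

(** Swapping the roles of [i] and [j] with the same [d] reverses the exchange, so a chain step can
    be read in whichever direction suits. *)
Lemma basic_exchange_sym (V : nmodType) (n : nat) (A : 'I_n -> set V)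
    (a b : {ffun 'I_n -> V}) :
  basic_exchange A a b -> basic_exchange A b a.
Proof.
move=> [Aa Ab [i [j [d [nij [Aid Ajd] ai bj ab]]]]]; split=> //.
exists j, i, d; split=> //; first by move=> ji; apply: nij.
by move=> k kj ki; rewrite ab.
Qed.

Lemma basic_exchange_absorb (V : nmodType) (n : nat) (A W : 'I_n -> set V) :
  (forall k x y, W k x -> W k y -> W k (x + y)) ->
  (forall k, summand_absorbing (W k) (A k)) ->
  (forall i j, i <> j -> W i `&` A j `<=` W j) ->
  forall a b : {ffun 'I_n -> V},
    basic_exchange A a b -> tuples_in W b -> basic_exchange W a b.
Proof.
move=> addW saW WAW a b [Aa Ab [i [j [d [nij [Aid Ajd] ai bj ab]]]]] Wb.
have [Waj Wjd] : W j (a j) /\ W j d.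
  by apply: saW => //; rewrite -bj; exact: Wb.
have Wid : W i d by apply: (WAW j i) => // ji; apply: nij.
split=> //; last by exists i, j, d; split.
(* Slot [i] of [a] is [b i + d], a sum of two members of [W i]; slot [j] is [Waj], and every other
   slot agrees with [b]. *)
move=> k; have [->|/eqP ki] := eqVneq k i; first by rewrite ai; exact: addW.
have [->//|/eqP kj] := eqVneq k j.
by rewrite ab.
Qed.

Lemma exchange_equivalent_absorb (V : nmodType) (n : nat)
    (A W : 'I_n -> set V) :
  (forall k x y, W k x -> W k y -> W k (x + y)) ->
  (forall k, summand_absorbing (W k) (A k)) ->
  (forall i j, i <> j -> W i `&` A j `<=` W j) ->
  forall a w : {ffun 'I_n -> V},
    tuples_in W w -> exchange_equivalent A a w -> exchange_equivalent W a w.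
Proof.
move=> addW saW WAW a w Ww [_ _ /clos_rt_rt1n_iff aw].
(* Unfolding the chain from its head keeps the end fixed. The tail from [b] already runs inside the
   [W k], so [b] lies there and draws [a] in. *)
elim: aw Ww => {a w} [a|a b c ab _ IH] Ww; first by split=> //; exact: rt_refl.
have [Wb Wc bc] := IH Ww.
have Wab : basic_exchange W a b.
  apply: (basic_exchange_absorb _ _ _ _ addW saW WAW) => //.
  by case: ab => // /basic_exchange_sym.
split=> //; first by case: Wab.
by apply: rt_trans bc; apply: rt_step; left.
Qed.

(** Passes from the boolean membership in [mem A] to plain application of the set [A]. *)
Lemma is_submoduleP (R : pzSemiRingType) (V : lSemiModType R) (A : set V) :
  is_submodule A <->
  [/\ A 0, forall x y, A x -> A y -> A (x + y) &
      forall (r : R) x, A x -> A (r *: x)].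
Proof.
split=> [[[A0 AD] AZ]|[A0 AD AZ]].
  split=> [|x y Ax Ay|r x Ax]; first exact: (set_mem A0).
    by apply: set_mem; apply: AD; apply: mem_set.
  by apply: set_mem; apply: AZ; apply: mem_set.
split; first split; first exact: mem_set.
  by move=> x y /set_mem Ax /set_mem Ay; apply: mem_set; apply: AD.
by move=> r x /set_mem Ax; apply: mem_set; apply: AZ.
Qed.

Lemma is_submodule_sumset (R : pzSemiRingType) (V : lSemiModType R) (n : nat)
    (W : 'I_n -> set V) :
  (forall k, is_submodule (W k)) -> is_submodule (sumset W).
Proof.
move=> subW; apply/is_submoduleP; split=> [|_ _ [a Wa <-] [b Wb <-]|r _ [a Wa <-]].
- exists [ffun=> 0]; last by apply: big1 => i _; rewrite ffunE.
  by move=> i; rewrite ffunE; have /is_submoduleP[] := subW i.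
- exists [ffun i => a i + b i].
    move=> i; rewrite ffunE; have /is_submoduleP[_ WD _] := subW i; exact: WD.
  by rewrite -big_split; apply: eq_bigr => i _; rewrite ffunE.
- exists [ffun i => r *: a i].
    move=> i; rewrite ffunE; have /is_submoduleP[_ _ WZ] := subW i; exact: WZ.
  by rewrite scaler_sumr; apply: eq_bigr => i _; rewrite ffunE.
Qed.

Theorem theorem4p6 (R : pzSemiRingType) (V : lSemiModType R) (n : nat)
    (A W : 'I_n -> set V)
    (subA : forall k : 'I_n, is_submodule (A k))
    (subW : forall k : 'I_n, is_submodule (W k))
    (WA : forall k : 'I_n, W k `<=` A k)
    (saW : forall k : 'I_n, summand_absorbing (W k) (A k))
    (WAW : forall i j : 'I_n, i <> j -> W i `&` A j `<=` W j)
    (amalgA : has_amalgamation A) :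
  (forall a w : {ffun 'I_n -> V}, tuples_in A a -> tuples_in W w ->
     exchange_equivalent A a w ->
     tuples_in W a /\ exchange_equivalent W a w) /\
  [/\ is_submodule (sumset W), sumset W `<=` sumset A &
      summand_absorbing (sumset W) (sumset A)].
Proof.
have addW k x y : W k x -> W k y -> W k (x + y).
  by have /is_submoduleP[_ WD _] := subW k; exact: WD.
have absorb := exchange_equivalent_absorb _ _ _ _ addW saW WAW.
(* For (a), equivalence inside the [W k] includes the membership of [a]. *)
split=> [a w _ Ww /(absorb _ _ Ww) Waw|]; first by split=> //; case: Waw.
split; first exact: is_submodule_sumset.
  by move=> _ [w Ww <-]; exists w => // k; apply: WA.
move=> _ _ [a Aa <-] [b Ab <-] [w Ww sumw].
(* The slotwise sum of [a] and [b] has the same total as [w], so amalgamation joins the two by a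
   chain, and absorption puts each [a i + b i] in [W i]. *)
have [Wab _ _] : exchange_equivalent W [ffun i => a i + b i] w.
  apply: absorb => //; apply: amalgA.
  - move=> i; rewrite ffunE; have /is_submoduleP[_ AD _] := subA i; exact: AD.
  - by move=> i; apply: WA.
  - by rewrite sumw -big_split; apply: eq_bigr => i _; rewrite ffunE.
(* Summand absorption in each slot separates [a i] from [b i], so the original tuples witness that
   both sums lie in [sumset W]. *)
have Wi i : W i (a i) /\ W i (b i).
  by apply: saW => //; have := Wab i; rewrite ffunE.
by split; [exists a|exists b] => // i; case: (Wi i).
Qed.
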